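(* Let $\psi:\mathbb R_+\to\mathbb R$ be any convex function, let $\epsilon'>0$, and let $\psi_\epsilon(q)=\psi(q)+\epsilon' q\log q$ for $q\ge0$. Then the function $v\mapsto\log\big({\psi_\epsilon^*}'(v)\big)$ is $\frac1{\epsilon'}$-Lipschitz on $\mathbb R$.
   Context: $\psi_\epsilon^*(v)=\max_{t\ge0}\{vt-\psi_\epsilon(t)\}$ is the Fenchel conjugate of $\psi_\epsilon$ (with $0\log0=0$) and ${\psi_\epsilon^*}'$ is its derivative. In the paper $\epsilon'=\epsilon/(2\log N)$ for a target accuracy $\epsilon>0$ and number of losses $N$. *)

(* Defs.v *)
From HB Require Import structures.
From mathcomp Require Import all_boot all_order all_algebra.
From mathcomp Require Export all_classical all_reals all_analysis.

Set Implicit Arguments.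
Unset Strict Implicit.
Unset Printing Implicit Defensive.

Import Order.TTheory GRing.Theory Num.Theory.
Import numFieldNormedType.Exports.
Local Open Scope classical_set_scope.
Local Open Scope ring_scope.

(* Functions on R_+ are represented by functions on R whose values at negative
   arguments are never used. At q = 0 the added term is 0 (0 log 0 = 0). *)
Definition entropy_reg (R : realType) (eps : R) (psi : R -> R) (q : R) : R :=
  psi q + eps * (q * ln q).

(* Real supremum, which is 0 by convention if the set is unbounded; it is the
   maximum exactly when some t satisfies fenchel_argmax f v t. *)
Definition fenchel_conj (R : realType) (f : R -> R) (v : R) : R :=
  sup [set v * t - f t | t in [set t : R | 0 <= t]].

Definition fenchel_argmax (R : realType) (f : R -> R) (v t : R) : Prop :=
  0 <= t /\ forall s : R, 0 <= s -> v * s - f s <= v * t - f t.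

(* Main.v *)
(* If t maximizes v q - psi q - eps q log q then t > 0, since the slope of
   q log q is -oo at 0, and v - eps (log t + 1) is a subgradient of psi at t.
   Subgradients are monotone, so for maximizers t at v and s at w
   eps (log s - log t) (s - t) <= (w - v) (s - t), which makes the logarithm of
   the maximizer (1/eps)-Lipschitz. In particular the maximizer depends
   continuously on v, and since (w - v) t <= psi^*(w) - psi^*(v) <= (w - v) s it
   is the derivative of the conjugate. *)
Require Import Defs.
From mathcomp Require Import all_boot all_order all_algebra.
From mathcomp Require Import all_classical all_reals all_analysis.
From mathcomp Require Import ring lra.
Import Order.TTheory GRing.Theory Num.Theory.
Import numFieldNormedType.Exports.
Local Open Scope classical_set_scope.
Local Open Scope ring_scope.

(** * Tangent bounds for [q * ln q] *)

Lemma ln_le_sub1 (R : realType) (x : R) : 0 < x -> ln x <= x - 1.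
Proof.
move=> x0; rewrite -[in ln x](subrK 1 x) addrC.
by apply: le_ln1Dx; rewrite ltrBrDl subrr.
Qed.

Lemma mulr_ln_ge_tangent (R : realType) (t q : R) : 0 < t -> 0 <= q ->
  (ln t + 1) * (q - t) <= q * ln q - t * ln t.
Proof.
move=> t0; rewrite le0r => /predU1P[->|q0].
  by rewrite mul0r; nra.
have := ln_le_sub1 _ _ (divr_gt0 t0 q0).
rewrite ln_div ?posrE// -(ler_pM2l q0) mulrBr mulrBr mulrCA mulfV ?gt_eqF//.
by nra.
Qed.

(** Multiplying [ln (q / t) <= q / t - 1] by [q] leaves an error quadratic in [q - t]; this replaces
    differentiating the entropy. *)
Lemma mulr_ln_le_tangent (R : realType) (t q : R) : 0 < t -> 0 <= q ->
  q * ln q - t * ln t <= (ln t + 1) * (q - t) + (q - t) ^+ 2 / t.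
Proof.
move=> t0; rewrite le0r => /predU1P[->|q0].
  have -> : (0 - t) ^+ 2 / t = t by field; rewrite gt_eqF.
  by rewrite mul0r; nra.
have := ln_le_sub1 _ _ (divr_gt0 q0 t0).
rewrite ln_div ?posrE// -(ler_pM2l q0).
have -> : (q - t) ^+ 2 / t = q * (q / t - 1) - (q - t) by field; rewrite gt_eqF.
by nra.
Qed.

(** * Convex functions on the half-line *)

Lemma convex_ge0_conv (R : realType) (psi : R -> R) :
  convex_function (`[0, +oo[%classic : set R) psi ->
  forall x y l : R, 0 <= x -> 0 <= y -> 0 <= l -> l <= 1 ->
  psi (l * x + (1 - l) * y) <= l * psi x + (1 - l) * psi y.
Proof.
move=> cvx x y l x0 y0 l0 l1.
by have /= := cvx (Itv01 l0 l1) x y; apply; rewrite inE/= in_itv/= andbT.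
Qed.

(** Three-point form of convexity, with denominators cleared so that coinciding points are allowed
    and linear arithmetic applies. *)
Lemma convex_ge0_slope (R : realType) (psi : R -> R) :
  convex_function (`[0, +oo[%classic : set R) psi ->
  forall x y z : R, 0 <= x -> x <= y -> y <= z ->
  (z - x) * psi y <= (z - y) * psi x + (y - x) * psi z.
Proof.
move=> cvx x y z x0 xy yz; have [xz|zx] := ltP x z; last first.
  have yx : y = x by lra.
  have {}zx : z = x by lra.
  by rewrite yx zx subrr !mul0r addr0.
have zx : 0 < z - x by lra.
have zx0 : z - x != 0 by rewrite gt_eqF.
pose l := (z - y) / (z - x).
have l0 : 0 <= l by rewrite divr_ge0 ?subr_ge0// ltW.
have l1 : l <= 1 by rewrite ler_pdivrMr// mul1r lerD2l lerN2.
have := convex_ge0_conv _ _ cvx x z l x0 (ltW (le_lt_trans x0 xz)) l0 l1.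
have -> : l * x + (1 - l) * z = y by rewrite /l; field.
rewrite -(ler_pM2l zx); congr (_ <= _).
by rewrite /l; field.
Qed.

(** The chords over [[0, x]] and [[x, x + 1]] bound the slopes at [x], so [psi] is Lipschitz around
    [x]. At 0 a convex function may jump. *)
Lemma convex_ge0_continuous (R : realType) (psi : R -> R) :
  convex_function (`[0, +oo[%classic : set R) psi ->
  forall x : R, 0 < x -> {for x, continuous psi}.
Proof.
move=> cvx x x0.
have slope := convex_ge0_slope _ _ cvx.
pose A := `|psi x - psi 0| / x; pose B := `|psi (x + 1) - psi x|.
have xA : psi 0 - psi x <= x * A.
  by rewrite /A mulrCA mulfV ?gt_eqF// mulr1 distrC ler_norm.
have xB : psi (x + 1) - psi x <= B := ler_norm _.
have x1 : x <= x + 1 by lra.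
have A0 : 0 <= A by rewrite divr_ge0 // ltW.
have B0 : 0 <= B := normr_ge0 _.
have lip y : 0 < y -> y < x + 1 -> `|psi x - psi y| <= (A + B) * `|x - y|.
  move=> y0 y1; have [yx|xy] := ltP y x.
    have s1 := slope 0 y x (lexx _) (ltW y0) (ltW yx).
    have s2 := slope y x (x + 1) (ltW y0) (ltW yx) x1.
    have d0 : 0 <= x - y by lra.
    have xA' := ler_wpM2l d0 xA; have xB' := ler_wpM2l d0 xB.
    have dA := mulr_ge0 d0 A0; have dB := mulr_ge0 d0 B0.
    have s1' : psi y - psi x <= (x - y) * A by rewrite -(ler_pM2l x0); lra.
    by rewrite (ger0_norm d0) ler_norml; apply/andP; split; lra.
  have s1 := slope 0 x y (lexx _) (ltW x0) xy.
  have s2 := slope x y (x + 1) (ltW x0) xy (ltW y1).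
  have d0 : 0 <= y - x by lra.
  have xA' := ler_wpM2l d0 xA; have xB' := ler_wpM2l d0 xB.
  have dA := mulr_ge0 d0 A0; have dB := mulr_ge0 d0 B0.
  have s1' : psi x - psi y <= (y - x) * A by rewrite -(ler_pM2l x0); lra.
  by rewrite [`|x - y|]distrC (ger0_norm d0) ler_norml; apply/andP; split; lra.
have C0 : 0 < A + B + 1 by lra.
apply/cvgrPdist_le => e e0; near=> y.
have y0 : 0 < y by near: y; exact: lt_nbhsr.
have y1 : y < x + 1 by near: y; apply: lt_nbhsl; lra.
apply: le_trans (lip _ y0 y1) _.
have yx : (A + B + 1) * `|x - y| <= e.
  rewrite mulrC -ler_pdivlMr//; near: y.
  by apply: cvgr_dist_le; [exact: cvg_id|exact: divr_gt0].
by apply: le_trans yx; rewrite ler_wpM2r// lerDl.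
Unshelve. all: by end_near. Qed.

(** * Existence and positivity of maximizers *)

Lemma entropy_reg_increasing_near0 (R : realType) (psi : R -> R) (eps v : R) :
  convex_function (`[0, +oo[%classic : set R) psi -> 0 < eps ->
  exists d : R, [/\ 0 < d, d < 1 & forall q, 0 <= q -> q < d ->
    v * q - entropy_reg eps psi q < v * d - entropy_reg eps psi d].
Proof.
move=> cvx e0; have slope := convex_ge0_slope _ _ cvx.
pose m := psi 2 - psi 1.
(* The [-1] gives [d < 1]; the [-2] leaves a margin [eps] in the strict bound [lnd]. *)
pose d := expR (Num.min (-1) ((v - m) / eps - 2)).
have d0 : 0 < d := expR_gt0 _.
have d1 : d < 1 by rewrite expR_lt1 gt_min ltrN10.
have lnd : eps * (ln d + 1) < v - m.
  rewrite -ltr_pdivlMl// mulrC expRK.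
  apply: (@le_lt_trans _ _ ((v - m) / eps - 2 + 1)); last lra.
  by rewrite lerD2r ge_min lexx orbT.
exists d; split=> // q q0 qd; rewrite /entropy_reg.
have ent := mulr_ln_ge_tangent _ _ _ d0 q0.
have s1 := slope q d 1 q0 (ltW qd) (ltW d1).
have s2 := slope d 1 2 (ltW d0) (ltW d1) (ler1n _ _).
have d1' : 0 < 1 - d by lra.
have dq : 0 < d - q by lra.
(* Chord slopes increase from [[q, d]] to [[d, 1]] to [[1, 2]], and the last one is [m]. *)
have psid : psi d - psi q <= (d - q) * m.
  by rewrite -(ler_pM2l d1') /m; nra.
have : eps * (d * ln d - q * ln q) <= eps * ((ln d + 1) * (d - q)).
  by rewrite ler_pM2l//; lra.
by move: lnd; rewrite -(ltr_pM2r dq); lra.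
Qed.

(** Convexity puts [psi] above its chord line through 0 and 1 beyond 1, and [eps * (q * ln q)]
    outgrows every linear function. *)
Lemma entropy_reg_coercive (R : realType) (psi : R -> R) (eps v : R) :
  convex_function (`[0, +oo[%classic : set R) psi -> 0 < eps ->
  exists K : R, 1 <= K /\ forall q, K <= q ->
    v * q - entropy_reg eps psi q <= v * 1 - entropy_reg eps psi 1.
Proof.
move=> cvx e0; have slope := convex_ge0_slope _ _ cvx.
pose c := v - psi 1 + psi 0.
(* Adding the absolute value makes the exponent nonnegative, so [1 <= K], and leaves a surplus that
   absorbs [- c]. *)
pose K := expR ((c + `|c|) / eps).
have K1 : 1 <= K.
  rewrite -expR0 ler_expR divr_ge0 //; last exact: ltW.
  by have := ler_norm (- c); rewrite normrN; lra.
exists K; split=> // q Kq.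
have q1 : 1 <= q := le_trans K1 Kq.
have lnq : c + `|c| <= eps * ln q.
  by rewrite mulrC -ler_pdivrMr// -ler_expR lnK// posrE (lt_le_trans ltr01).
have := slope 0 1 q (lexx _) ler01 q1.
rewrite /entropy_reg ln1 => s1.
have lnq' : q * (c + `|c|) <= q * (eps * ln q).
  by rewrite ler_pM2l// (lt_le_trans ltr01).
have c0 : `|c| <= q * `|c| by rewrite ler_peMl.
have := ler_norm (- c); rewrite normrN.
by rewrite /c in lnq' c0 *; lra.
Qed.

Lemma entropy_reg_argmax_exists (R : realType) (psi : R -> R) (eps v : R) :
  convex_function (`[0, +oo[%classic : set R) psi -> 0 < eps ->
  exists t, fenchel_argmax (entropy_reg eps psi) v t.
Proof.
move=> cvx e0.
have [d [d0 d1 dmax]] := entropy_reg_increasing_near0 _ _ _ v cvx e0.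
have [K [K1 Kmax]] := entropy_reg_coercive _ _ _ v cvx e0.
(* The extreme value theorem is applied on [[d, K]], away from the possible jump at 0. Points left
   of [d] lose to [d], points right of [K] lose to 1. *)
have dK := ltW (lt_le_trans d1 K1).
have [|t] := @EVT_max R (fun q => v * q - entropy_reg eps psi q) d K dK.
  apply: continuous_in_subspaceT => q; rewrite inE/= in_itv/= => /andP[dq _].
  have q0 := lt_le_trans d0 dq.
  apply: cvgB; first by apply: cvgMl_tmp; exact: cvg_id.
  apply: cvgD; first exact: convex_ge0_continuous.
  by apply: cvgMl_tmp; apply: cvgM; [exact: cvg_id|exact: continuous_ln].
rewrite in_itv/= => /andP[dt tK] tmax.
exists t; split; first exact: ltW (lt_le_trans d0 dt).
move=> s s0; have [sd|ds] := ltP s d.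
  apply: le_trans (ltW (dmax _ s0 sd)) (tmax _ _).
  by rewrite in_itv/= lexx; lra.
have [Ks|sK] := leP K s.
  apply: le_trans (Kmax _ Ks) (tmax _ _).
  by rewrite in_itv/= K1 ltW.
by apply: tmax; rewrite in_itv/= ds ltW.
Qed.

Lemma entropy_reg_argmax_gt0 (R : realType) (psi : R -> R)
    (eps v t : R) :
  convex_function (`[0, +oo[%classic : set R) psi -> 0 < eps ->
  fenchel_argmax (entropy_reg eps psi) v t -> 0 < t.
Proof.
move=> cvx e0 [t0 tmax]; rewrite lt_def t0 andbT; apply/eqP => t_eq0.
have [d [d0 d1 /(_ 0 (lexx _) d0)]] :=
  entropy_reg_increasing_near0 _ _ _ v cvx e0.
by rewrite ltNge -t_eq0 tmax// ltW.
Qed.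

(** * Subgradients and the Lipschitz bound *)

Lemma entropy_reg_argmax_subgradient (R : realType) (psi : R -> R)
    (eps v t : R) :
  convex_function (`[0, +oo[%classic : set R) psi -> 0 < eps ->
  fenchel_argmax (entropy_reg eps psi) v t ->
  forall s, 0 <= s -> (v - eps * (ln t + 1)) * (s - t) <= psi s - psi t.
Proof.
move=> cvx e0 ht s s0.
have t0 := entropy_reg_argmax_gt0 _ _ _ _ _ cvx e0 ht.
have {ht} [_ tmax] := ht.
set a := v - _; pose C := eps * ((s - t) ^+ 2 / t).
have C0 : 0 <= C by rewrite mulr_ge0 ?divr_ge0 ?sqr_ge0 ?(ltW e0) ?(ltW t0).
(* Compare t with t + l (s - t): the entropy is tangent to first order, so the
   error is of order l^2, and l can be taken arbitrarily small. *)
suff H l : 0 < l -> l <= 1 -> a * (s - t) - l * C <= psi s - psi t.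
  apply/ler_addgt0Pr => e egt0.
  (* The [+ 1] keeps the denominator positive when [C] is 0. *)
  pose l := Num.min 1 (e / (C + 1)).
  have C1 : 0 < C + 1 by lra.
  have l0 : 0 < l by rewrite lt_min ltr01 divr_gt0.
  have l1 : l <= 1 by rewrite ge_min lexx.
  have le : l * (C + 1) <= e by rewrite -ler_pdivlMr// ge_min lexx orbT.
  by have := H _ l0 l1; nra.
move=> l0 l1.
have q0 : 0 <= l * s + (1 - l) * t by nra.
have h1 := convex_ge0_conv _ _ cvx s t l s0 (ltW t0) (ltW l0) l1.
have h2 := mulr_ln_le_tangent _ _ _ t0 q0.
have h3 := tmax _ q0.
move: h1 h2 h3; rewrite /entropy_reg.
have -> : (l * s + (1 - l) * t - t) ^+ 2 / t = l ^+ 2 * ((s - t) ^+ 2 / t).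
  by field; rewrite gt_eqF.
set q := l * s + _; set L := ln q => h1 h2 h3.
rewrite -(ler_pM2l l0).
have h4 : eps * (q * L - t * ln t) <=
   eps * ((ln t + 1) * (q - t)) + l ^+ 2 * C.
  by rewrite /C; move: h2; rewrite -(ler_pM2l e0); lra.
have qt : q - t = l * (s - t) by rewrite /q; ring.
rewrite qt in h4.
have vq : v * (q - t) = v * (l * (s - t)) by rewrite qt.
rewrite /a; nra.
Qed.

Lemma ln_entropy_reg_argmax_lipschitz (R : realType) (psi : R -> R)
    (eps v w s t : R) :
  convex_function (`[0, +oo[%classic : set R) psi -> 0 < eps ->
  fenchel_argmax (entropy_reg eps psi) v t ->
  fenchel_argmax (entropy_reg eps psi) w s ->
  `|ln s - ln t| <= eps^-1 * `|w - v|.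
Proof.
move=> cvx e0 ht hs.
have t0 := entropy_reg_argmax_gt0 _ _ _ _ _ cvx e0 ht.
have s0 := entropy_reg_argmax_gt0 _ _ _ _ _ cvx e0 hs.
have h1 := entropy_reg_argmax_subgradient _ _ _ _ _ cvx e0 ht _ (ltW s0).
have h2 := entropy_reg_argmax_subgradient _ _ _ _ _ cvx e0 hs _ (ltW t0).
have {h1 h2} h : eps * (ln s - ln t) * (s - t) <= (w - v) * (s - t) by nra.
rewrite ler_pdivlMl//.
(* [ln s - ln t] has the sign of [s - t], so cancelling [s - t] in [h] bounds the absolute value. *)
have [st|ts|->] := ltgtP s t; last by rewrite subrr normr0 mulr0.
- have lst : ln s <= ln t by rewrite ler_ln ?posrE// ltW.
  rewrite ler0_norm ?subr_le0//.
  have := ler_norm (- (w - v)); rewrite normrN.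
  by move: h; rewrite ler_nM2r ?subr_lt0//; lra.
- have lst : ln t <= ln s by rewrite ler_ln ?posrE// ltW.
  rewrite ger0_norm ?subr_ge0//.
  have := ler_norm (w - v).
  by move: h; rewrite ler_pM2r ?subr_gt0//; lra.
Qed.

(** * The conjugate and its derivative *)

Lemma fenchel_conj_argmax (R : realType) (f : R -> R) (v t : R) :
  fenchel_argmax f v t -> fenchel_conj f v = v * t - f t.
Proof.
move=> [t0 tmax]; apply/eqP; rewrite eq_le; apply/andP; split.
  by apply: ge_sup; [exists (v * t - f t), t|move=> _ [s s0 <-]; exact: tmax].
apply: ub_le_sup; last by exists t.
by exists (v * t - f t) => _ [s s0 <-]; exact: tmax.
Qed.

(** Each maximizer is a competitor in the problem of the other. *)
Lemma fenchel_conj_slope_between (R : realType) (f : R -> R) (v w s t : R) :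
  fenchel_argmax f v t -> fenchel_argmax f w s ->
  (w - v) * t <= fenchel_conj f w - fenchel_conj f v <= (w - v) * s.
Proof.
move=> ht hs.
rewrite (fenchel_conj_argmax _ _ _ _ ht) (fenchel_conj_argmax _ _ _ _ hs).
have [[t0 ht'] [s0 hs']] := (ht, hs).
by have := ht' _ s0; have := hs' _ t0; lra.
Qed.

Lemma is_derive_fenchel_conj_entropy_reg (R : realType) (psi : R -> R)
    (eps v t : R) :
  convex_function (`[0, +oo[%classic : set R) psi -> 0 < eps ->
  fenchel_argmax (entropy_reg eps psi) v t ->
  is_derive v 1 (fenchel_conj (entropy_reg eps psi)) t.
Proof.
move=> cvx e0 ht; set F := fenchel_conj _.
have t0 := entropy_reg_argmax_gt0 _ _ _ _ _ cvx e0 ht.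
suff cv : h^-1 *: ((F \o shift v) (h *: 1) - F v) @[h --> 0^'] --> t.
  apply: DeriveDef; first by apply/cvg_ex; exists t.
  exact/cvg_lim.
(* [g h] bounds the distance from [t] to a maximizer [s] at [h + v], because
   [s = t * expR (ln s - ln t)] and the exponent is at most [eps^-1 * |h|] in absolute value. *)
pose g (h : R) := t * (expR (eps^-1 * `|h|) - 1).
have g0 : g h @[h --> 0^'] --> (0 : R).
  have {2}<- : g 0 = 0 by rewrite /g normr0 mulr0 expR0 subrr mulr0.
  apply/(@continuous_withinNx R R g).
  apply: cvgMl_tmp; apply: cvgB; last exact: cvg_cst.
  apply: continuous_comp; last exact: continuous_expR.
  by apply: cvgMl_tmp; exact: norm_continuous.
apply: (@squeeze_cvgr _ _ _ _ (fun h => t - g h) (fun h => t + g h)).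
- near=> h.
  have h0 : h != 0 by near: h; exact: nbhs_dnbhs_neq.
  have [s hs] := entropy_reg_argmax_exists _ _ _ (h + v) cvx e0.
  have s0 := entropy_reg_argmax_gt0 _ _ _ _ _ cvx e0 hs.
  have := ln_entropy_reg_argmax_lipschitz _ _ _ _ _ _ _ cvx e0 ht hs.
  have := fenchel_conj_slope_between _ _ _ _ _ _ ht hs.
  rewrite addrK -/F /= [h *: 1]mulr1 /g; set M := eps^-1 * _.
  move=> /andP[q1 q2] /ler_normlP[u1 u2].
  (* With [e1] this yields [1 - expR (ln s - ln t) <= M <= expR M - 1], so the same [g h] also
     serves when [s < t]. *)
  have eN : 1 - M <= expR (ln s - ln t).
    by apply: le_trans (expR_ge1Dx _); lra.
  have eM : expR (ln s - ln t) <= expR M by rewrite ler_expR.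
  have e1 : 1 + M <= expR M := expR_ge1Dx _.
  have st : s = t * expR (ln s - ln t).
    by rewrite expRD expRN !lnK ?posrE//; field; rewrite gt_eqF.
  have s1 : s - t <= t * (expR M - 1) by rewrite [in leLHS]st; nra.
  have s2 : t - s <= t * (expR M - 1) by rewrite [in leLHS]st; nra.
  set Q := _ *: _.
  have QE : h * Q = F (h + v) - F v.
    by rewrite /Q [_ *: _]mulrC mulrCA mulfV ?mulr1.
  (* The quotient [Q] lies between [s] and [t], in an order set by the sign of [h]; [hp] is the
     negative case. *)
  have [hp|hn|h_eq0] := ltgtP h 0; last by rewrite h_eq0 eqxx in h0.
    have Qt : Q <= t by rewrite -(ler_nM2l hp) QE.
    have sQ : s <= Q by rewrite -(ler_nM2l hp) QE.
    by apply/andP; split; lra.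
  have Qt : t <= Q by rewrite -(ler_pM2l hn) QE.
  have sQ : Q <= s by rewrite -(ler_pM2l hn) QE.
  by apply/andP; split; lra.
- by rewrite -[X in _ --> X]subr0; apply: cvgB => //; exact: cvg_cst.
- by rewrite -[X in _ --> X]addr0; apply: cvgD => //; exact: cvg_cst.
Unshelve. all: by end_near. Qed.

(** The first three clauses show that the total functions [sup], [derive1] and [ln] are not at
    default values, so the Lipschitz clause concerns the true derivative of a true maximum. *)
Theorem lemma4 (R : realType) (psi : R -> R) (eps : R)
    (psi_convex : convex_function (`[0, +oo[%classic : set R) psi)
    (eps_gt0 : 0 < eps) :
  let psi_star := fenchel_conj (entropy_reg eps psi) in
  [/\ forall v : R, exists t : R, fenchel_argmax (entropy_reg eps psi) v t,
      forall v : R, derivable psi_star v 1,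
      forall v : R, 0 < derive1 psi_star v
    & (eps^-1).-lipschitz (fun v : R => ln (derive1 psi_star v))].
Proof.
move=> psi_star.
have ex v := entropy_reg_argmax_exists _ _ _ v psi_convex eps_gt0.
have der v t := is_derive_fenchel_conj_entropy_reg _ _ _ v t psi_convex eps_gt0.
have d1 v t :
    fenchel_argmax (entropy_reg eps psi) v t -> derive1 psi_star v = t.
  by move=> /der ?; rewrite derive1E; exact: derive_val.
split=> // [v|v|[w v] _ /=].
- by have [t /der[]] := ex v.
- have [t ht] := ex v; rewrite (d1 _ _ ht).
  exact: entropy_reg_argmax_gt0 ht.
- have [[t ht] [s hs]] := (ex v, ex w); rewrite (d1 _ _ ht) (d1 _ _ hs).
  exact: ln_entropy_reg_argmax_lipschitz ht hs.
Qed.
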